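(* Let $n\ge 1$ be an integer and let $X$ be an $S(n)$-$\theta$-closed $S(n)$-space. Then $X$ is weakly $S(n)$-$\theta$-closed.
   Context: All neighborhoods are open; $\mathrm{cl}\,M$ is the closure. $\theta^n$-closure ($n\ge1$): $x\notin \mathrm{cl}_{\theta^n}M$ iff there are open neighborhoods $U_1,\dots,U_n$ of $x$ with $\mathrm{cl}\,U_i\subseteq U_{i+1}$ for $i=1,\dots,n-1$ and $\mathrm{cl}\,U_n\cap M=\emptyset$. For $n=1$ write $\mathrm{cl}_\theta=\mathrm{cl}_{\theta^1}$; $M$ is $\theta$-closed if $M=\mathrm{cl}_\theta M$. $X$ is an $S(n)$-space if $x\notin\mathrm{cl}_{\theta^n}\{y\}$ for any two distinct points $x,y\in X$. An $S(n)$-space is $S(n)$-$\theta$-closed if it is $\theta$-closed in every $S(n)$-space containing it as a subspace. An $n$-hull of a point $x$ is a neighborhood $U$ of $x$ for which there are neighborhoods $U_1,\dots,U_n=U$ of $x$ with $\mathrm{cl}\,U_i\subseteq U_{i+1}$ for $i=1,\dots,n-1$. A point $x$ is a $\theta^0(n)$-complete accumulation point of an infinite set $F$ if $|F\cap U|=|F|$ for every $n$-hull $U$ of $x$. $X$ is weakly $S(n)$-$\theta$-closed if every infinite subset of $X$ whose cardinality is a regular cardinal has a $\theta^0(n)$-complete accumulation point in $X$. *)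

(* Defs.v *)
From mathcomp Require Import all_boot all_order.
From mathcomp Require Import boolp classical_sets functions cardinality topology.

Set Implicit Arguments.
Unset Strict Implicit.
Unset Printing Implicit Defensive.

Local Open Scope classical_set_scope.
Local Open Scope card_scope.

(* Only the values U 1, ..., U n matter. *)
Definition nbhs_chain (X : topologicalType) (n : nat) (x : X)
    (U : nat -> set X) : Prop :=
  (forall i, 1 <= i <= n -> open_nbhs x (U i)) /\
  (forall i, 1 <= i < n -> closure (U i) `<=` U i.+1).

Definition theta_closure (X : topologicalType) (n : nat) (M : set X) : set X :=
  [set x | ~ exists2 U : nat -> set X,
             nbhs_chain n x U & closure (U n) `&` M = set0].

Definition theta_closed (X : topologicalType) (M : set X) : Prop :=
  M = theta_closure 1 M.

Definition S_space (n : nat) (X : topologicalType) : Prop :=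
  forall x y : X, x <> y -> ~ theta_closure n [set y] x.

(* "Y contains X as a subspace", up to the identification of X with its
   homeomorphic image range e in Y. *)
Definition subspace_embedding (X Y : topologicalType) (e : X -> Y) : Prop :=
  injective e /\
  forall U : set X, open U <-> exists2 V : set Y, open V & U = e @^-1` V.

Definition S_theta_closed (n : nat) (X : topologicalType) : Prop :=
  S_space n X /\
  forall (Y : topologicalType) (e : X -> Y),
    S_space n Y -> subspace_embedding e -> theta_closed (range e).

Definition hull (X : topologicalType) (n : nat) (x : X) (V : set X) : Prop :=
  exists2 U : nat -> set X, nbhs_chain n x U & U n = V.

Definition theta0_complete_accumulation_point (X : topologicalType) (n : nat)
    (F : set X) (x : X) : Prop :=
  forall V : set X, hull n x V -> F `&` V #= F.

Definition card_lt (T U : Type) (A : set T) (B : set U) : Prop :=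
  A #<= B /\ ~ (A #= B).

(* The cardinal |F| is regular: it is infinite and F is not the union of fewer
   than |F| sets, each of cardinality less than |F|. *)
Definition regular_cardinality (T : Type) (F : set T) : Prop :=
  infinite_set F /\
  forall C : set (set T), card_lt C F -> (forall A, C A -> card_lt A F) ->
    F <> \bigcup_(A in C) A.

Definition weakly_S_theta_closed (n : nat) (X : topologicalType) : Prop :=
  forall F : set X, infinite_set F -> regular_cardinality F ->
    exists x : X, theta0_complete_accumulation_point n F x.

(* Main.v *)
Require Import Defs.
From mathcomp Require Import all_boot all_order.
From mathcomp Require Import boolp classical_sets functions cardinality topology.
From mathcomp Require Import zify.
From HB Require Import structures.

(** In an S(n)-theta-closed space, every cover by n-hulls has a finite subcover.
    Otherwise let S be a cover by n-hulls without finite subcover, and enlarge X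
    by a sequence of isolated points (x, 0), (x, 1), ... converging to each x and
    by a point p whose neighborhoods contain all the (x, k) with x outside a
    finite union of members of S. A chain witnessing an n-hull in S then separates
    its center from p, so the extension is S(n); but every neighborhood of p has
    a point of X in its closure. The theorem follows: if F had no
    theta^0(n)-complete accumulation point, the hulls V with |F `&` V| < |F|
    would cover X, and F would be a finite union of sets of smaller cardinality. *)

Set Implicit Arguments.
Unset Strict Implicit.
Unset Printing Implicit Defensive.

Local Open Scope classical_set_scope.
Local Open Scope card_scope.

(** * The ideal of finitely covered sets *)

Section FinitelyCovered.
Variables (X : Type) (S : set (set X)).

Definition finitely_covered (A : set X) : Prop :=
  exists C : set (set X),
    [/\ finite_set C, C `<=` S & A `<=` \bigcup_(B in C) B].

Lemma finitely_covered0 : finitely_covered set0.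
Proof. by exists set0; split => //; exact: finite_set0. Qed.

Lemma finitely_coveredU A B :
  finitely_covered A -> finitely_covered B -> finitely_covered (A `|` B).
Proof.
move=> [C [fC CS AC]] [D [fD DS BD]]; exists (C `|` D); split.
- by rewrite finite_setU.
- by move=> E [/CS|/DS].
- by rewrite bigcup_setU; exact: setUSS.
Qed.

Lemma finitely_covered_sub A B :
  A `<=` B -> finitely_covered B -> finitely_covered A.
Proof.
by move=> AB [C [fC CS BC]]; exists C; split => //; exact: subset_trans BC.
Qed.

Lemma finitely_covered1 A : S A -> finitely_covered A.
Proof.
move=> SA; exists [set A]; split; first exact: finite_set1.
- by move=> _ ->.
- by rewrite bigcup_set1.
Qed.

End FinitelyCovered.

(** * Closures and neighborhood chains *)

Lemma open_not_closure (X : topologicalType) (A W : set X) x :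
  open W -> W x -> A `&` W = set0 -> ~ closure A x.
Proof.
move=> oW Wx AW0 /(_ W)[|y]; first exact: open_nbhs_nbhs.
by rewrite AW0.
Qed.

Lemma closure_setC_closure (X : topologicalType) (W : set X) :
  open W -> closure (~` closure W) `<=` ~` W.
Proof.
move=> oW; rewrite [X in _ `<=` X]((closure_id _).1 (open_closedC oW)).
exact/closureS/subsetC/subset_closure.
Qed.

Lemma nbhs_chainI (X : topologicalType) n (x : X) U V :
  nbhs_chain n x U -> nbhs_chain n x V ->
  nbhs_chain n x (fun i => U i `&` V i).
Proof.
move=> [oU cU] [oV cV]; split=> i hi.
- have [[oUi Uix] [oVi Vix]] := (oU _ hi, oV _ hi).
  by split; [exact: openI|].
- by move=> y /closureI[Uy Vy]; split; [exact: cU Uy|exact: cV Vy].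
Qed.

Lemma nbhs_chain_le (X : topologicalType) n (x : X) U i j :
  nbhs_chain n x U -> 1 <= i -> i <= j -> j <= n -> U i `<=` U j.
Proof.
move=> [_ cU] i1; elim: j => [|j IHj].
  by rewrite leqn0 => /eqP ij; rewrite ij in i1.
rewrite leq_eqVlt => /orP[/eqP-> _ //|]; rewrite ltnS => ij jn.
apply: subset_trans (IHj ij (ltnW jn)) _.
apply: subset_trans (@subset_closure _ _) _.
by apply: cU; rewrite (leq_trans i1 ij).
Qed.

Lemma not_theta_closure1P (X : topologicalType) n (x y : X) :
  ~ theta_closure n [set y] x <->
  exists2 U, nbhs_chain n x U & ~ closure (U n) y.
Proof.
split=> [/contrapT[U Ux Uy]|[U Ux Uy]].
  by exists U => // cy; rewrite -[False]/(set0 y) -Uy.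
apply; exists U => //; rewrite -subset0 => z [cz zy].
by apply: Uy; rewrite -zy.
Qed.

(** The complements of the closures of a chain at [x], in reverse order, form a chain at [y]. By
    this symmetry each pair of points of the extension needs a separating chain on one side only. *)
Lemma not_theta_closure1C (X : topologicalType) n (x y : X) : 1 <= n ->
  ~ theta_closure n [set y] x -> ~ theta_closure n [set x] y.
Proof.
move=> n1 /not_theta_closure1P[U Ux ncy]; have [oU cU] := Ux.
apply/not_theta_closure1P; exists (fun i => ~` closure (U (n.+1 - i))).
- split=> i /andP[i1 ile].
  + split; first exact/closed_openC/closed_closure.
    apply: contra_not ncy; apply: closureS.
    by apply: (nbhs_chain_le Ux); lia.
  + have -> : n.+1 - i = (n.+1 - i.+1).+1 by lia.
    have [oU' _] : open_nbhs x (U (n.+1 - i.+1).+1) by apply: oU; lia.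
    apply: subset_trans (closure_setC_closure oU') _.
    by apply: subsetC; apply: cU; lia.
- rewrite subSnn => clx.
  have [oU1 U1x] : open_nbhs x (U 1) by apply: oU; rewrite n1.
  exact: closure_setC_closure clx U1x.
Qed.

(** The points of the extension are [Some (inl x)] for x in X, the isolated
    points [Some (inr (x, k))], and the point at infinity [None]. *)
Definition extension (X : topologicalType) (S : set (set X)) : Type :=
  option (X + X * nat).

HB.instance Definition _ X S := Choice.on (@extension X S).

(** * Topology of the extension *)

Section Extension.
Variables (X : topologicalType) (S : set (set X)).
Notation Y := (extension S).
Implicit Types (U V : set X) (O : set Y).

Definition ext_pt (x : X) : Y := Some (inl x).
Definition ext_iso (x : X) (k : nat) : Y := Some (inr (x, k)).
Definition ext_infty : Y := None.

(** The last clause constrains isolated points only, so a neighborhood of infinity may miss X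
    altogether; without a finite subcover its closure still meets X. *)
Definition ext_open O : Prop :=
  [/\ open (ext_pt @^-1` O),
      forall x, O (ext_pt x) ->
        exists m, forall k, m <= k -> O (ext_iso x k)
    & O ext_infty ->
        finitely_covered S [set x | exists k, ~ O (ext_iso x k)]].

Lemma ext_openT : ext_open setT.
Proof.
split=> [|x _|_]; first exact: openT.
- by exists 0.
- by apply: finitely_covered_sub (finitely_covered0 S) => x [k]; apply.
Qed.

Lemma ext_openI : setI_closed ext_open.
Proof.
move=> O O' [oO sO iO] [oO' sO' iO']; split.
- by rewrite preimage_setI; exact: openI.
- move=> x [/sO[m Om] /sO'[m' Om']]; exists (maxn m m') => k.
  by rewrite geq_max => /andP[/Om ? /Om'].
- move=> [/iO fO /iO' fO'].
  apply: finitely_covered_sub (finitely_coveredU fO fO') => x [k].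
  by move/not_andP => [|] ?; [left|right]; exists k.
Qed.

Lemma ext_open_bigcup (I : Type) (f : I -> set Y) :
  (forall i, ext_open (f i)) -> ext_open (\bigcup_i f i).
Proof.
move=> fo; split.
- by rewrite preimage_bigcup; apply: bigcup_open => i _; have [] := fo i.
- move=> x [i _ fx]; have [_ /(_ _ fx)[m fm] _] := fo i.
  by exists m => k /fm ?; exists i.
- move=> [i _ fi]; have [_ _ /(_ fi)] := fo i.
  apply: finitely_covered_sub => x [k nk].
  by exists k => fk; apply: nk; exists i.
Qed.

(** [extension] carries [S] as a parameter so that this topology can depend on the cover. *)
HB.instance Definition _ :=
  isOpenTopological.Build Y ext_openT ext_openI ext_open_bigcup.

Lemma ext_openE O : open O = ext_open O.
Proof. by []. Qed.

Definition cylinder U : set Y := fun y =>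
  match y with
  | Some (inl x) | Some (inr (x, _)) => U x
  | None => False
  end.

Lemma open_cylinder U : open U -> open (cylinder U).
Proof. by move=> oU; rewrite ext_openE; split=> // x Ux; exists 0. Qed.

Lemma ext_pt_embedding : subspace_embedding ext_pt.
Proof.
split=> [x y [] //|U]; split=> [oU|[V [oV _ _] ->] //].
by exists (cylinder U) => //; exact: open_cylinder.
Qed.

Lemma open_ext_iso x k : open [set ext_iso x k].
Proof.
rewrite ext_openE; split=> //.
by rewrite (_ : _ @^-1` _ = set0); [exact: open0|apply/seteqP; split].
Qed.

(** Infinity stays outside the closure: once [U] is finitely covered, the isolated points off the
    cylinder form an open set together with infinity. *)
Lemma closure_cylinder U :
  finitely_covered S U -> closure (cylinder U) `<=` cylinder (closure U).
Proof.
move=> fU [[x|[x k]]|] cly /=.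
- apply: contrapT => ncx.
  have oW : open (~` closure U) by exact/closed_openC/closed_closure.
  apply: (open_not_closure (open_cylinder oW) _ _ cly) => //.
  by rewrite -subset0 => -[[z|[z k]]|] //= [Uz]; apply; exact: subset_closure.
- apply: subset_closure; apply: contrapT => nUx.
  apply: (open_not_closure (open_ext_iso x k) _ _ cly) => //.
  by rewrite -subset0 => y [Uy yx]; apply: nUx; rewrite yx in Uy.
- have oW : open (~` cylinder U `\` range ext_pt).
    rewrite ext_openE; split.
    + rewrite (_ : _ @^-1` _ = set0); first exact: open0.
      by rewrite -subset0 => x [_]; apply; exists x.
    + by move=> x [_ /(_ (ex_intro2 _ _ x I erefl))].
    + move=> _; apply: finitely_covered_sub fU => x [k] /not_andP[/contrapT//|].
      by move=> /contrapT [].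
  apply: (open_not_closure oW _ _ cly); first by split=> // -[].
  by rewrite -subset0 => y [Uy []].
Qed.

Lemma nbhs_chain_cylinder n (x : X) (U : nat -> set X) : finitely_covered S (U n) ->
  nbhs_chain n x U -> nbhs_chain n (ext_pt x) (fun i => cylinder (U i)).
Proof.
move=> fU Ux; have [oU cU] := Ux; split=> i hi.
- by have [oUi Uix] := oU _ hi; split => //; exact: open_cylinder.
- have [i1 iln] := andP hi.
  have fUi : finitely_covered S (U i).
    by apply: finitely_covered_sub fU; apply: nbhs_chain_le Ux _ _ _ => //; lia.
  apply: subset_trans (closure_cylinder fUi) _.
  by case=> [[z|[z k]]|] //=; exact: cU.
Qed.

Hypothesis S_cover : forall x, exists2 V, S V & V x.

Lemma closed_ext_iso x k : closed [set ext_iso x k].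
Proof.
rewrite -openC ext_openE; split.
- by rewrite (_ : _ @^-1` _ = setT); [exact: openT|apply/seteqP; split].
- by move=> z _; exists k.+1 => j kj [_ jk]; rewrite jk ltnn in kj.
(* The point x lies in a member of S, so {x} is finitely covered and the complement is a
   neighborhood of infinity. *)
- move=> _; have [V SV Vx] := S_cover x.
  by apply: finitely_covered_sub (finitely_covered1 SV) => z [j] /contrapT [->].
Qed.

End Extension.

(** * Separation of points in the extension *)

Section ExtensionSeparation.
Variables (n : nat) (X : topologicalType) (S : set (set X)).
Hypotheses (n_gt0 : 1 <= n) (XS : S_space n X).
Hypothesis S_hull : forall x, exists2 V, S V & hull n x V.
Notation Y := (extension S).

Let S_chain x : exists2 V, finitely_covered S (V n) & nbhs_chain n x V.
Proof.
have [W SW [V Vx VW]] := S_hull x; exists V => //.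
by rewrite VW; exact: finitely_covered1.
Qed.

Let S_cover x : exists2 V, S V & V x.
Proof.
have [V SV [U [oU _] UV]] := S_hull x; exists V => //.
by rewrite -UV; have [] := oU n; rewrite ?n_gt0 /=.
Qed.

Lemma ext_iso_separated (y : Y) x k :
  ext_iso S x k <> y -> ~ theta_closure n [set y] (ext_iso S x k).
Proof.
have cI : closed [set ext_iso S x k] by exact: closed_ext_iso.
(* The singleton is clopen, so a constant chain serves for every n. *)
move=> xy; apply/not_theta_closure1P; exists (fun=> [set ext_iso S x k]).
- split=> i _; first by split=> //; exact: open_ext_iso.
  by rewrite -(closure_id _).1.
- by rewrite -(closure_id _).1//; apply: nesym.
Qed.

Lemma ext_infty_separated x :
  ~ theta_closure n [set ext_infty S] (ext_pt S x).
Proof.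
have [V fV Vx] := S_chain x; apply/not_theta_closure1P.
exists (fun i => cylinder (V i)); first exact: nbhs_chain_cylinder.
by move=> /closure_cylinder -/(_ fV).
Qed.

(** Intersecting a separating chain in X with a chain ending in a finitely covered set makes the
    last set finitely covered, so the cylinders again form a chain. *)
Lemma ext_pt_separated x y :
  x <> y -> ~ theta_closure n [set ext_pt S y] (ext_pt S x).
Proof.
move=> /XS/not_theta_closure1P[U Ux ncy]; have [V fV Vx] := S_chain x.
have fUV : finitely_covered S (U n `&` V n) by exact: finitely_covered_sub fV.
apply/not_theta_closure1P; exists (fun i => cylinder (U i `&` V i)).
  by apply: (nbhs_chain_cylinder fUV); exact: nbhs_chainI.
by move=> /(closure_cylinder fUV)/closureI[].
Qed.

Lemma S_space_extension : S_space n Y.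
Proof.
have [isoC inftyC] := (ext_iso_separated, ext_infty_separated).
move=> [[x|[x k]]|] [[y|[y l]]|] xy //.
- by apply: ext_pt_separated => yx; apply: xy; rewrite yx.
- by apply/(not_theta_closure1C n_gt0)/isoC/nesym.
- exact: inftyC.
- exact: isoC.
- exact: isoC.
- exact: isoC.
- exact/(not_theta_closure1C n_gt0)/inftyC.
- by apply/(not_theta_closure1C n_gt0)/isoC/nesym.
Qed.

End ExtensionSeparation.

(** An open set around infinity omits terms of the sequence at x only for a finitely covered set of
    x, hence not for every x. At a remaining x the whole sequence lies in the open set and its limit
    in the closure. *)
Lemma ext_infty_theta_closure (X : topologicalType) (S : set (set X)) :
  ~ finitely_covered S setT -> theta_closure 1 (range (ext_pt S)) (ext_infty S).
Proof.
move=> nS [U [/(_ 1)[//|oU U1] _] clU].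
have [_ _ /(_ U1) fS] : ext_open (U 1) by [].
have [x xU] : exists x, forall k, U 1 (ext_iso S x k).
  apply: contrapT => nx; apply: nS; apply: finitely_covered_sub fS => x _ /=.
  by apply: contrapT => /forallNP xU; apply: nx; exists x => k; exact: contrapT.
suff : (closure (U 1) `&` range (ext_pt S)) (ext_pt S x) by rewrite clU.
split; last by exists x.
apply: contrapT => nc.
have oC : open (~` closure (U 1)) by exact/closed_openC/closed_closure.
have [_ /(_ _ nc)[m mU] _] : ext_open _ := oC.
exact: (mU m (leqnn m)) (subset_closure (xU m)).
Qed.

Lemma S_theta_closed_hull_cover n (X : topologicalType) (S : set (set X)) :
  1 <= n -> S_theta_closed n X -> (forall x, exists2 V, S V & hull n x V) ->
  finitely_covered S setT.
Proof.
move=> n1 [XS Xclosed] S_hull; apply: contrapT => nS.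
have YS := S_space_extension n1 XS S_hull.
have := ext_infty_theta_closure nS.
(* Theta-closedness would put infinity in the range of [ext_pt]. *)
by rewrite -(Xclosed _ _ YS (ext_pt_embedding S)) => -[].
Qed.

(** * Regular cardinals and finite covers *)

Lemma finite_card_lt (T U : Type) (A : set T) (B : set U) :
  finite_set A -> infinite_set B -> card_lt A B.
Proof.
move=> fA iB; split; last by move=> /card_eqPle[_ /card_le_finite/(_ fA)].
have /finite_set_leP[m Am] := fA.
have /infiniteP Bnat := iB.
by apply: card_le_trans Am (card_le_trans _ Bnat); exact: subset_card_le.
Qed.

(** A finite family is smaller than the infinite [F], so the traces on [F] of a finite cover would
    violate regularity. *)
Lemma regular_not_finitely_covered (T : Type) (F : set T) :
  regular_cardinality F ->
  ~ finitely_covered [set A | card_lt (F `&` A) F] setT.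
Proof.
move=> [iF rF] [C [fC CS cover]].
apply: (rF [set F `&` A | A in C]).
- exact/finite_card_lt/iF/finite_image.
- by move=> _ [A /CS ? <-].
- apply/seteqP; split=> [x Fx|x [_ [A _ <-]] []//].
  have [A CA Ax] := cover x I.
  by exists (F `&` A) => //; exists A.
Qed.

Theorem theorem3p5 (n : nat) (hn : 1 <= n) (X : topologicalType)
    (hS : S_space n X) (hX : S_theta_closed n X) : weakly_S_theta_closed n X.
Proof.
move=> F _ rF; apply: contrapT => nacc.
apply: (regular_not_finitely_covered rF).
apply: (S_theta_closed_hull_cover hn hX) => x.
apply: contrapT => nV; apply: nacc; exists x => V hV.
(* Since F ∩ V is a subset of F, it can fail to have cardinality |F| only by being smaller, which
   puts V in the cover. *)
apply: contrapT => FV; apply: nV; exists V => //; split=> //.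
by apply: subset_card_le; exact: subIsetl.
Qed.
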